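(* Let $m\geq 2$ be an integer and let $H$ be a normalized symmetric real Hadamard matrix of order $4m$. Let \[b=-1+\frac{1}{2m-2}\pm\mathbf{i}\frac{\sqrt{4m-5}}{2m-2}\] (either choice of sign). Delete the first row and first column of $H$, and in the resulting $(4m-1)\times(4m-1)$ matrix replace every off-diagonal entry $-1$ with $b$ and every diagonal entry $1$ with $-b$ (off-diagonal entries $1$ and diagonal entries $-1$ are kept unchanged). The resulting matrix is a complex Hadamard matrix of order $4m-1$.
   Context: A complex Hadamard matrix of order $n$ is an $n\times n$ matrix $H$ with unimodular complex entries satisfying $HH^\ast=nI$; a real Hadamard matrix is one with entries $\pm1$. A Hadamard matrix is normalized if all entries of its first row and first column equal $1$. *)

(* Defs.v *)
From mathcomp Require Export all_boot all_order all_algebra.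
From mathcomp Require Export sesquilinear spectral.
From mathcomp Require Export reals complex.

Set Implicit Arguments.
Unset Strict Implicit.
Unset Printing Implicit Defensive.

Import Order.TTheory GRing.Theory Num.Theory.

Local Open Scope ring_scope.
Local Open Scope sesquilinear_scope.
Local Open Scope complex_scope.

Definition complex_hadamard (R : realType) (n : nat) (H : 'M[R[i]]_n) : Prop :=
  (forall i j, `|H i j| = 1) /\ H *m H ^t* = n%:R%:M.

Definition real_hadamard (R : realType) (n : nat) (H : 'M[R[i]]_n) : Prop :=
  complex_hadamard H /\ forall i j, H i j = 1 \/ H i j = -1.

Definition normalized (R : realType) (n : nat) (H : 'M[R[i]]_n.+1) : Prop :=
  forall i, H ord0 i = 1 /\ H i ord0 = 1.

Definition core (R : realType) (n : nat) (H : 'M[R[i]]_n.+1) : 'M[R[i]]_n :=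
  row' ord0 (col' ord0 H).

Definition replace_entries (R : realType) (n : nat) (b : R[i])
    (K : 'M[R[i]]_n) : 'M[R[i]]_n :=
  \matrix_(i, j)
    if i == j then (if K i j == 1 then - b else K i j)
    else (if K i j == -1 then b else K i j).

(* Main.v *)
Require Import Defs.
From mathcomp Require Import ring lra.

Set Implicit Arguments.
Unset Strict Implicit.

Import Order.TTheory GRing.Theory Num.Theory.
Local Open Scope complex_scope.
Local Open Scope ring_scope.

(** On and off the diagonal alike, the new matrix is
    [(1 - b)/2 * K + (1 + b)/2 * (J - 2 I)], where [K] is the core of [H] and
    [J] the all-ones matrix. Since [K] is symmetric with [K K^T = 4m I - J] and
    [K J = - J], the product with the adjoint has a [K]-term with coefficient
    proportional to the real part of [(1 - b)(1 + conj b)], which vanishes as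
    [|b| = 1]; the [J]-term vanishes because [|1 + b|^2 = 1/(m - 1)]. *)

(** Bilinear expansion, with [(J - 2 I)^2 = (n - 4) J + 4 I]. The coefficients [p'], [q'] are
    independent of [p], [q] so that they can later be the conjugates. *)
Lemma sum_shifted_rows (F : comPzRingType) (n : nat) (K : 'M[F]_n)
    (p q p' q' : F) (i j : 'I_n) :
  \sum_k (p * K i k + q * (1 - 2 * (i == k)%:R))
       * (p' * K j k + q' * (1 - 2 * (j == k)%:R)) =
  p * p' * (\sum_k K i k * K j k)
  + p * q' * (\sum_k K i k - 2 * K i j)
  + q * p' * (\sum_k K j k - 2 * K j i)
  + q * q' * (n%:R - 4 + 4 * (i == j)%:R).
Proof.
have delta (l : 'I_n) (f : 'I_n -> F) : \sum_k (l == k)%:R * f k = f l.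
  rewrite (bigD1 l) //= eqxx mul1r big1 ?addr0 // => k.
  by rewrite eq_sym => /negPf->; rewrite mul0r.
(* The factors [* 1] let [delta] apply with a constant function. *)
have -> : n%:R - 4 + 4 * (i == j)%:R = \sum_(k < n) (1 - 2 * ((i == k)%:R * 1)
    - 2 * ((j == k)%:R * 1) + 4 * ((i == k)%:R * (j == k)%:R)) :> F.
  rewrite !big_split /= !sumrN -!mulr_sumr !delta sumr_const card_ord eq_sym.
  ring.
(* With [K i j] and [K j i] turned back into sums, the identity holds summand by summand. *)
rewrite -(delta j (K i)) -(delta i (K j)) !mulr_sumr -!sumrB !mulr_sumr.
rewrite -!big_split /=; apply: eq_bigr => k _; ring.
Qed.

Lemma norm1_conj (R : realType) (z : R[i]) : z * z^* = 1 -> `|z| = 1.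
Proof. by rewrite -normCK => /eqP; rewrite sqrp_eq1 // => /eqP. Qed.

(** The modulus comes from [(2m - 3)^2 + (4m - 5) = (2m - 2)^2]. Given it, [b + b^* + 2] is
    [|1 + b|^2]. Both facts are blind to the choice of sign. *)
Lemma parameter_conj (R : realType) (m : nat) (b : R[i]) : (2 <= m)%N ->
  b = (-1 + (2 * m%:R - 2)^-1)
              +i* (Num.sqrt (4 * m%:R - 5) / (2 * m%:R - 2))
  \/ b = (-1 + (2 * m%:R - 2)^-1)
              -i* (Num.sqrt (4 * m%:R - 5) / (2 * m%:R - 2)) ->
  b * b^* = 1 /\ (b + b^* + 2) * (m%:R - 1) = 1.
Proof.
move=> hm.
have hm2 : 2 <= m%:R :> R by rewrite ler_nat.
set s := Num.sqrt _.
(* Since [m >= 2], the radicand is nonnegative and [Num.sqrt] is a true root. *)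
have ss : s ^+ 2 = 4 * m%:R - 5 by rewrite sqr_sqrtr //; lra.
have nz : 2 * m%:R - 2 != 0 :> R by lra.
have mE : m%:R - 1 = (m%:R - 1 : R)%:C by rewrite rmorphB rmorph_nat rmorph1.
have twoE : 2 = (2 : R)%:C by rewrite rmorph_nat.
rewrite mE twoE.
have sq : s / (2 * m%:R - 2) * (s / (2 * m%:R - 2)) =
    (4 * m%:R - 5) / (2 * m%:R - 2) ^+ 2.
  by rewrite -expr2 expr_div_n ss.
by case=> ->; split; apply/eqP; rewrite eq_complex /=; apply/andP; split;
  apply/eqP; rewrite ?mulrN ?mulNr ?opprK ?sq; field.
Qed.

Section Core.
Variables (R : realType) (m n : nat) (H : 'M[R[i]]_n.+1).
Hypotheses (hn : n.+1 = (4 * m)%N) (hH : real_hadamard H) (hnorm : normalized H).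

Lemma core_pm1 i j : core H i j = 1 \/ core H i j = -1.
Proof. by rewrite !mxE; apply: hH.2. Qed.

Lemma hadamard_rows i j : \sum_k H i k * H j k = (4 * m * (i == j))%:R.
Proof.
have [[_ hHH] hpm] := hH.
have := congr1 (fun A : 'M_n.+1 => A i j) hHH; rewrite !mxE => E.
rewrite natrM -hn mulr_natr -E; apply: eq_bigr => k _; rewrite !mxE.
by case: (hpm j k) => ->; rewrite ?rmorphN rmorph1.
Qed.

(** Each later row of [H] starts with 1 and is orthogonal to the all-ones first row. *)
Lemma core_row_sum i : \sum_k core H i k = -1.
Proof.
have := hadamard_rows (lift ord0 i) ord0.
rewrite big_ord_recl /= (hnorm _).2 (hnorm _).1 muln0 mul1r.
under eq_bigr do rewrite (hnorm _).1 mulr1.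
move=> /eqP; rewrite addrC addr_eq0 => /eqP <-.
by apply: eq_bigr => k _; rewrite !mxE.
Qed.

Lemma core_rows i j :
  \sum_k core H i k * core H j k = 4 * m%:R * (i == j)%:R - 1.
Proof.
have := hadamard_rows (lift ord0 i) (lift ord0 j).
rewrite big_ord_recl /= !(hnorm _).2 mul1r (inj_eq lift_inj) !natrM => <-.
rewrite addrAC subrr add0r.
by apply: eq_bigr => k _; rewrite !mxE.
Qed.
End Core.

(** Affine interpolation in [K i j]: the values at 1 and -1 are 1 and [b] off the diagonal, [-b] and
    -1 on it. Both lines have slope [(1 - b)/2], and their constant terms are opposite. *)
Lemma replace_entriesE (R : realType) (n : nat) (b : R[i])
    (K : 'M[R[i]]_n) :
  (forall i j, K i j = 1 \/ K i j = -1) ->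
  forall i j, replace_entries b K i j =
    (1 - b) / 2 * K i j + (1 + b) / 2 * (1 - 2 * (i == j)%:R).
Proof.
move=> hK i j; rewrite mxE.
have n1 : (1 == -1 :> R[i]) = false by rewrite eq_sym eqNr oner_eq0.
by case: eqP => _; case: (hK i j) => ->; rewrite ?eqxx ?n1
  1?eq_sym ?n1 /=; field.
Qed.

Lemma replace_entries_conj (R : realType) (n : nat) (b : R[i])
    (K : 'M[R[i]]_n) :
  (forall i j, K i j = 1 \/ K i j = -1) ->
  forall i j, (replace_entries b K i j)^* = replace_entries b^* K i j.
Proof.
move=> hK i j; rewrite !mxE.
by case: (hK i j) => ->; case: ifP => _; case: ifP => _;
  rewrite ?rmorphN ?rmorph1.
Qed.

Theorem theorem3 (R : realType) (m n : nat) (b : R[i]) (H : 'M[R[i]]_n.+1)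
    (hm : (2 <= m)%N) (hn : n.+1 = (4 * m)%N)
    (hH : real_hadamard H) (hnorm : normalized H) (hsym : H^T = H)
    (hb : b = (-1 + (2 * m%:R - 2)^-1)
              +i* (Num.sqrt (4 * m%:R - 5) / (2 * m%:R - 2))
       \/ b = (-1 + (2 * m%:R - 2)^-1)
              -i* (Num.sqrt (4 * m%:R - 5) / (2 * m%:R - 2))) :
  complex_hadamard (replace_entries b (core H)).
Proof.
have [bb bm] := parameter_conj hm hb.
have hK := core_pm1 hH.
have nb := norm1_conj bb.
split=> [i j|].
  by rewrite mxE; case: ifP => _; case: ifP => _ //; rewrite ?normrN //;
    case: (hK i j) => ->; rewrite ?normrN normr1.
apply/matrixP=> i j; rewrite !mxE.
have conjE k : (replace_entries b (core H) ^t*)%sesqui k j =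
    (1 - b^*) / 2 * core H j k + (1 + b^*) / 2 * (1 - 2 * (j == k)%:R).
  rewrite -(replace_entriesE _ hK) -(replace_entries_conj _ hK).
  by rewrite [LHS]mxE [in LHS]mxE.
under eq_bigr do rewrite conjE (replace_entriesE _ hK).
rewrite sum_shifted_rows (core_rows hn hH hnorm) !(core_row_sum hn hH hnorm).
(* Symmetry of [H] lets the two cross terms combine. *)
have -> : core H j i = core H i j.
  by rewrite !mxE -{1}hsym mxE.
have nE : n%:R = 4 * m%:R - 1 :> R[i].
  by rewrite -natrM -hn -addn1 natrD addrK.
rewrite nE -[RHS]mulr_natr.
set c := b^* in bb bm *; set M : R[i] := m%:R in bm *; set d : R[i] := (i == j)%:R.
set k := core H i j.
have b0 : b != 0.
  by apply/eqP=> b0; move/eqP: bb; rewrite b0 mul0r eq_sym oner_eq0.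
have cE : c = b^-1 by rewrite -[c](mulKf b0) bb mulr1.
(* If [b = -1], then [b + c + 2 = 0], contradicting [bm]. *)
have b1 : b + 1 != 0.
  apply/eqP=> /eqP; rewrite addr_eq0 => /eqP b1; move/eqP: bm.
  by rewrite cE b1 invrN invr1 -opprD addNr mul0r eq_sym oner_eq0.
(* Solving [bm] for [M] leaves a rational identity in [b], with [k] and [d] as free variables. *)
have -> : M = b / (b + 1) ^+ 2 + 1.
  have bcE : b + c + 2 = (b + 1) ^+ 2 / b by rewrite cE; field.
  apply/eqP; rewrite -subr_eq; apply/eqP.
  by rewrite -[b / _]mulr1 -[X in _ = _ * X]bm bcE; field; rewrite b0.
by rewrite cE; field; rewrite b0 b1.
Qed.
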